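(* Let $k_0(x)=\frac{e^{-x}}{x}$ for real $x\ne0$, and let $W_0$, $W_{-1}$ be the real branches of the Lambert $W$ function. Then, for real $x$, $$W_0(x)\equiv\begin{cases}\dfrac{1}{\mathrm{inverse}_1(k_0)(x)}, & x>0;\\[2mm] 0, & x=0;\\[1mm] \dfrac{1}{\mathrm{inverse}_0(k_0)(x)}, & -\frac1e\le x<0;\end{cases}$$ and $$W_{-1}(x)\equiv\dfrac{1}{\mathrm{inverse}_{-1}(k_0)(x)}\quad\text{for } -\frac1e\le x<0.$$
   Context: $W_0$ and $W_{-1}$ are the real branches of the Lambert $W$ function, that is, of the solution $w=W(d)$ of $we^w=d$: $W_0:[-1/e,\infty)\to[-1,\infty)$ and $W_{-1}:[-1/e,0)\to(-\infty,-1]$. $k_0(x)=e^{-x}/x$ is the modified spherical Bessel function of the second kind of order $0$ (normalized without a factor $\pi/2$). The nonzero reals are partitioned into the maximal intervals on which $k_0$ is continuous and monotonic, each including its left endpoint when that is finite and not a pole, and excluding its right endpoint; these are branch $-1$: $(-\infty,-1)$, branch $0$: $[-1,0)$, and branch $1$: $(0,\infty)$. $\mathrm{inverse}_b(k_0)(c)$ denotes the real solution $x$ in branch interval $b$ of $k_0(x)=c$.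
   Formalization: The printed 1/inverse_b(k_0)(x) is false (e.g. at x=1) or undefined for x<0; it is replaced by inverse_b(k_0)(1/x), with unique existence of the inverse. At x=-1/e the W_{-1} formula, undefined as branch -1 excludes -1, is stated as a limit from the right. *)

(* Defs.v *)
From Stdlib Require Import Reals ZArith ClassicalEpsilon.
Open Scope R_scope.

(* The unique real satisfying P; unspecified when there is no such real
   or more than one. *)
Definition the_real (P : R -> Prop) : R := epsilon (inhabits 0) (unique P).

(* W_0 and W_{-1} are meaningful for -1/e <= d and -1/e <= d < 0 only. *)
Definition W_0 (d : R) : R :=
  the_real (fun w => -1 <= w /\ w * exp w = d).

Definition W_m1 (d : R) : R :=
  the_real (fun w => w <= -1 /\ w * exp w = d).

Definition k_0 (x : R) : R := exp (- x) / x.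

(* The maximal intervals on which k_0 is continuous and monotonic, each with
   its left endpoint when that is finite and not the pole 0. *)
Definition branch_k_0 (b : Z) (x : R) : Prop :=
  match b with
  | (-1)%Z => x < -1
  | 0%Z => -1 <= x < 0
  | 1%Z => 0 < x
  | _ => False
  end.

Definition solution_k_0 (b : Z) (c x : R) : Prop :=
  branch_k_0 b x /\ k_0 x = c.

Definition inverse_k_0 (b : Z) (c : R) : R := the_real (solution_k_0 b c).

Definition inverse_k_0_defined (b : Z) (c : R) : Prop :=
  exists! x, solution_k_0 b c x.

(* Main.v *)
Require Import Defs.
From Stdlib Require Import Reals ZArith.
From Stdlib Require Import Lra ClassicalEpsilon.
Open Scope R_scope.

(** For nonzero [w] and [x], the equation [k_0 w = 1 / x] is the reciprocal of
    [w * exp w = x], so an inverse of [k_0] at [1 / x] and a value of the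
    Lambert function at [x] solve the same equation ([k_0_eq_inv_iff]).  What
    remains is that the branches match.  The map [w * exp w] strictly increases
    on [[-1, +oo)] ([mul_exp_increasing]), strictly decreases on [(-oo, -1]]
    ([mul_exp_decreasing]), and has the sign of [w]; hence for [x <> 0] the
    branches 1 and 0 of [k_0] cut [[-1, +oo)] according to the sign of [x],
    and the branch -1 only misses the turning point [w = -1].  Existence of the
    solutions is the intermediate value theorem.

    At [x = -1 / exp 1] the lower Lambert branch takes the value -1, which
    branch -1 of [k_0] excludes, so there the value is obtained as a limit.
    A solution [w < -1] of [w * exp w = x] exceeds [-1 - eps] as soon as [x] is
    below the value of [w * exp w] at [-1 - eps], which by monotonicity is
    strictly above [-1 / exp 1]. *)

Lemma the_real_eq (P : R -> Prop) (r : R) : unique P r -> the_real P = r.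
Proof.
  intros Hr.
  assert (Hu : unique P (the_real P)).
  { unfold the_real. apply epsilon_spec. now exists r. }
  symmetry. apply (proj2 Hr), (proj1 Hu).
Qed.

Lemma k_0_eq_inv_iff (x w : R) :
  x <> 0 -> w <> 0 -> (k_0 w = 1 / x <-> w * exp w = x).
Proof.
  intros Hx Hw. unfold k_0. rewrite exp_Ropp.
  pose proof (exp_pos w) as He.
  replace (/ exp w / w) with (/ (w * exp w)) by (field; lra).
  unfold Rdiv. rewrite Rmult_1_l. split; intros H.
  - now apply Rinv_eq_reg.
  - now rewrite H.
Qed.

Lemma mul_exp_m1 : -1 * exp (-1) = -1 / exp 1.
Proof.
  replace (exp (-1)) with (/ exp 1); [reflexivity |].
  symmetry. exact (exp_Ropp 1).
Qed.

(** For [a < 0] divide by [exp b]: the tangent bound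
    [exp (a - b) > 1 + (a - b)] gives [a * exp (a - b) < a * (1 + a - b)], and
    [b - a * (1 + a - b) = (b - a) * (1 + a) >= 0].  This avoids derivatives. *)
Lemma mul_exp_increasing (a b : R) :
  -1 <= a -> a < b -> a * exp a < b * exp b.
Proof.
  intros Ha Hab.
  pose proof (exp_pos a). pose proof (exp_pos b).
  destruct (Rle_lt_dec 0 a) as [Ha0 | Ha0].
  - pose proof (exp_increasing a b Hab). nra.
  - assert (Ht : 1 + (a - b) < exp (a - b)) by (apply exp_ineq1; lra).
    assert (He : exp a = exp (a - b) * exp b)
      by (rewrite <- exp_plus; f_equal; lra).
    assert (Hs : a * exp (a - b) < b) by nra.
    rewrite He. nra.
Qed.

(** The same tangent bound, now divided by [exp a]:
    [b * exp (b - a) < b * (1 + b - a)], and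
    [a - b * (1 + b - a) = (a - b) * (1 + b) >= 0]. *)
Lemma mul_exp_decreasing (a b : R) :
  b <= -1 -> a < b -> b * exp b < a * exp a.
Proof.
  intros Hb Hab.
  pose proof (exp_pos a).
  assert (Ht : 1 + (b - a) < exp (b - a)) by (apply exp_ineq1; lra).
  assert (He : exp b = exp (b - a) * exp a)
    by (rewrite <- exp_plus; f_equal; lra).
  assert (Hs : b * exp (b - a) < a) by nra.
  rewrite He. nra.
Qed.

Lemma mul_exp_inj_upper (a b : R) :
  -1 <= a -> -1 <= b -> a * exp a = b * exp b -> a = b.
Proof.
  intros Ha Hb H. destruct (Rtotal_order a b) as [L | [E | L]]; [| exact E |].
  - pose proof (mul_exp_increasing a b Ha L). lra.
  - pose proof (mul_exp_increasing b a Hb L). lra.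
Qed.

Lemma mul_exp_inj_lower (a b : R) :
  a <= -1 -> b <= -1 -> a * exp a = b * exp b -> a = b.
Proof.
  intros Ha Hb H. destruct (Rtotal_order a b) as [L | [E | L]]; [| exact E |].
  - pose proof (mul_exp_decreasing a b Hb L). lra.
  - pose proof (mul_exp_decreasing b a Ha L). lra.
Qed.

Lemma mul_exp_IVT (a b x : R) :
  a <= b -> (a * exp a - x) * (b * exp b - x) <= 0 ->
  exists w, a <= w <= b /\ w * exp w = x.
Proof.
  intros Hab Hs.
  assert (Hc : continuity (fun w => w * exp w - x)).
  { apply derivable_continuous. intros w.
    apply (derivable_pt_minus (fun w => w * exp w) (fun _ => x)).
    - apply (derivable_pt_mult (fun w => w) exp).
      + apply derivable_pt_id.
      + apply derivable_pt_exp.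
    - apply derivable_pt_const. }
  destruct (IVT_cor _ a b Hc Hab Hs) as [w [Hw Hz]].
  exists w. split; [exact Hw | lra].
Qed.

Lemma mul_exp_upper_solution (x : R) :
  -1 / exp 1 <= x -> exists w, -1 <= w /\ w * exp w = x.
Proof.
  intros Hx. rewrite <- mul_exp_m1 in Hx.
  (* Since exp is at least 1 on nonnegative reals, w = |x| overshoots x. *)
  pose proof (Rabs_pos x). pose proof (Rle_abs x).
  assert (1 <= exp (Rabs x)) by (pose proof (exp_ineq1_le (Rabs x)); lra).
  destruct (mul_exp_IVT (-1) (Rabs x) x) as [w [Hw E]].
  - lra.
  - assert (x <= Rabs x * exp (Rabs x)) by nra. nra.
  - exists w. split; [lra | exact E].
Qed.

Lemma mul_exp_lower_solution (x : R) :
  -1 / exp 1 <= x < 0 -> exists w, w <= -1 /\ w * exp w = x.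
Proof.
  intros [Hx Hx0]. rewrite <- mul_exp_m1 in Hx.
  assert (Hx1 : -1 < x).
  { assert (exp (-1) < 1) by (rewrite <- exp_0; apply exp_increasing; lra).
    lra. }
  (* Squaring exp (u/2) > u/2 gives u * exp (- u) < 4 / u, so the left
     endpoint - u with u = -4 / x has a value above x. *)
  set (u := -4 / x).
  assert (Hux : u * x = -4) by (unfold u; field; lra).
  assert (Hu : 4 < u) by nra.
  assert (Hh : u / 2 < exp (u / 2)) by (pose proof (exp_ineq1_le (u / 2)); lra).
  assert (Hsq : exp u = exp (u / 2) * exp (u / 2))
    by (rewrite <- exp_plus; f_equal; lra).
  assert (Hinv : exp (- u) * exp u = 1)
    by (rewrite <- exp_plus, <- exp_0; f_equal; lra).
  pose proof (exp_pos (- u)) as Hp.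
  assert (Hbig : u * u / 4 < exp u) by (rewrite Hsq; nra).
  assert (Hsmall : exp (- u) * (u * u) < 4) by nra.
  assert (Hval : x < - u * exp (- u)) by nra.
  destruct (mul_exp_IVT (- u) (-1) x) as [w [Hw E]].
  - lra.
  - nra.
  - exists w. split; [lra | exact E].
Qed.

Lemma W_0_eq (x w : R) : -1 <= w -> w * exp w = x -> W_0 x = w.
Proof.
  intros Hw E. apply the_real_eq. split; [now split |].
  intros v [Hv Ev]. apply mul_exp_inj_upper; congruence || assumption.
Qed.

Lemma W_m1_eq (x w : R) : w <= -1 -> w * exp w = x -> W_m1 x = w.
Proof.
  intros Hw E. apply the_real_eq. split; [now split |].
  intros v [Hv Ev]. apply mul_exp_inj_lower; congruence || assumption.
Qed.

Lemma branch_k_0_neq0 (b : Z) (w : R) : branch_k_0 b w -> w <> 0.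
Proof.
  destruct b as [| [] | []]; simpl; intros H; lra || contradiction.
Qed.

Lemma solution_k_0_inv_iff (b : Z) (x w : R) :
  x <> 0 ->
  (solution_k_0 b (1 / x) w <-> branch_k_0 b w /\ w * exp w = x).
Proof.
  intros Hx. unfold solution_k_0.
  split; intros [Hb H]; split; try exact Hb;
    now apply (k_0_eq_inv_iff x w Hx (branch_k_0_neq0 b w Hb)).
Qed.

(** Each branch of [k_0] lies on one side of -1, where [w * exp w] is
    injective. *)
Lemma mul_exp_inj_branch (b : Z) (v w : R) :
  branch_k_0 b v -> branch_k_0 b w -> v * exp v = w * exp w -> v = w.
Proof.
  destruct b as [| [] | []]; simpl; intros Hv Hw E; try contradiction.
  - apply mul_exp_inj_upper; lra.
  - apply mul_exp_inj_upper; lra.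
  - apply mul_exp_inj_lower; lra.
Qed.

Lemma solution_k_0_unique (b : Z) (x w : R) :
  x <> 0 -> branch_k_0 b w -> w * exp w = x ->
  unique (solution_k_0 b (1 / x)) w.
Proof.
  intros Hx Hb E. split.
  - now apply solution_k_0_inv_iff.
  - intros v Hv. apply (solution_k_0_inv_iff b x v Hx) in Hv as [Hv Ev].
    apply (mul_exp_inj_branch b); congruence || assumption.
Qed.

Lemma inverse_k_0_inv (b : Z) (x w : R) :
  x <> 0 -> branch_k_0 b w -> w * exp w = x ->
  inverse_k_0_defined b (1 / x) /\ inverse_k_0 b (1 / x) = w.
Proof.
  intros Hx Hb E.
  pose proof (solution_k_0_unique b x w Hx Hb E) as Hu.
  split; [now exists w | now apply the_real_eq].
Qed.

Lemma mul_exp_branch_m1_solution (x : R) :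
  -1 / exp 1 < x < 0 -> exists w, w < -1 /\ w * exp w = x.
Proof.
  intros Hx.
  destruct (mul_exp_lower_solution x) as [w [[Hw | ->] E]]; [lra | |].
  - now exists w.
  - rewrite mul_exp_m1 in E. lra.
Qed.

Theorem mainTheorem6 :
  (forall x : R, 0 < x ->
     inverse_k_0_defined 1 (1 / x) /\ W_0 x = inverse_k_0 1 (1 / x)) /\
  W_0 0 = 0 /\
  (forall x : R, -1 / exp 1 <= x < 0 ->
     inverse_k_0_defined 0 (1 / x) /\ W_0 x = inverse_k_0 0 (1 / x)) /\
  (forall x : R, -1 / exp 1 < x < 0 ->
     inverse_k_0_defined (-1) (1 / x) /\ W_m1 x = inverse_k_0 (-1) (1 / x)) /\
  limit1_in (fun x : R => inverse_k_0 (-1) (1 / x))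
    (fun x : R => -1 / exp 1 < x < 0) (W_m1 (-1 / exp 1)) (-1 / exp 1).
Proof.
  split; [| split; [| split; [| split]]].
  - intros x Hx.
    destruct (mul_exp_upper_solution x) as [w [Hw E]].
    { rewrite <- mul_exp_m1. pose proof (exp_pos (-1)). lra. }
    rewrite (W_0_eq x w Hw E).
    destruct (inverse_k_0_inv 1 x w) as [Hd Hi]; [lra | | exact E |].
    { simpl. pose proof (exp_pos w). nra. }
    now split.
  - apply W_0_eq; lra.
  - intros x Hx.
    destruct (mul_exp_upper_solution x) as [w [Hw E]]; [lra |].
    rewrite (W_0_eq x w Hw E).
    destruct (inverse_k_0_inv 0 x w) as [Hd Hi]; [lra | | exact E |].
    { simpl. pose proof (exp_pos w). nra. }
    now split.
  - intros x Hx.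
    destruct (mul_exp_branch_m1_solution x Hx) as [w [Hw E]].
    rewrite (W_m1_eq x w (Rlt_le _ _ Hw) E).
    destruct (inverse_k_0_inv (-1) x w) as [Hd Hi]; [lra | exact Hw | exact E |].
    now split.
  - rewrite (W_m1_eq _ (-1) (Rle_refl _) mul_exp_m1).
    intros eps Heps.
    (* The value of w * exp w at -1 - eps is the threshold for x. *)
    exists ((-1 - eps) * exp (-1 - eps) - -1 / exp 1). split.
    + pose proof (mul_exp_decreasing (-1 - eps) (-1)) as Hd.
      rewrite mul_exp_m1 in Hd. apply Rlt_gt. lra.
    + intros x [Hx Hdist]. simpl in *. unfold Rdist in *.
      apply Rabs_def2 in Hdist as [Hdist _].
      destruct (mul_exp_branch_m1_solution x Hx) as [w [Hw E]].
      destruct (inverse_k_0_inv (-1) x w) as [_ ->]; [lra | exact Hw | exact E |].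
      assert (-1 - eps < w).
      { destruct (Rle_lt_dec w (-1 - eps)) as [[L | ->] | L]; [| lra | exact L].
        pose proof (mul_exp_decreasing w (-1 - eps)). lra. }
      apply Rabs_def1; lra.
Qed.
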